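(* Let $(\Sigma,\partial)$ be a differential field whose field of constants $\mathbf{C}$ is algebraically closed and of characteristic zero. Let $L\in\Sigma[\partial]\setminus\mathbf{C}[\partial]$ be a third order operator whose centralizer $\mathcal{Z}(L)$ is nontrivial, and let $\Gamma$ be the spectral curve of $L$. Then $L-\lambda$ has an order one right factor $\partial+\phi$ in $\Sigma(\Gamma)[\partial]$ (called the intrinsic right factor). Moreover, given any basis $\{1,A_1,A_2\}$ of $\mathcal{Z}(L)$ as a $\mathbf{C}[L]$-module, this factor is the greatest common right divisor in $\Sigma(\Gamma)[\partial]$ $$\partial+\phi=\gcd\nolimits_{\mathrm{right}}(L-\lambda,A_1-\mu_1,A_2-\mu_2).$$
   Context: $\Sigma[\partial]$ is the ring of differential operators with coefficients in $\Sigma$ ($\partial a=a\partial+\partial(a)$). $\mathcal{Z}(L)=\{A\in\Sigma[\partial]\mid LA=AL\}$ is the centralizer of $L$; it is a commutative domain, and it is called nontrivial if $\mathcal{Z}(L)\neq\mathbf{C}[L]$. In that case $\mathcal{Z}(L)$ is a free $\mathbf{C}[L]$-module of rank $3$; bases $\{1,A_1,A_2\}$ are taken with $A_i$ of minimal order among the elements of $\mathcal{Z}(L)$ of order congruent to $i$ modulo $3$. $\lambda,\mu_1,\mu_2$ are algebraic variables over $\Sigma$ with zero derivative. Given a basis $\{1,A_1,A_2\}$, $\mathrm{BC}(L)=\{g\in\mathbf{C}[\lambda,\mu_1,\mu_2]\mid g(L,A_1,A_2)=0\}$, and the spectral curve of $L$ is $\Gamma=V(\mathrm{BC}(L))\subset\mathbf{C}^3$.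 Let $[\mathrm{BC}(L)]$ be the differential ideal generated by $\mathrm{BC}(L)$ in $\Sigma[\lambda,\mu_1,\mu_2]$ (it is prime). $\Sigma[\Gamma]=\Sigma[\lambda,\mu_1,\mu_2]/[\mathrm{BC}(L)]$ is a differential domain with the derivation induced by $\partial$, and $\Sigma(\Gamma)$ is its fraction field with the extended derivation. The operators $L-\lambda$, $A_i-\mu_i$ are regarded as elements of $\Sigma(\Gamma)[\partial]$ by taking classes of their coefficients. $\gcd_{\mathrm{right}}$ denotes the monic greatest common right divisor in the Euclidean domain $\Sigma(\Gamma)[\partial]$. *)

(* Defs.v *)
From HB Require Import structures.
From mathcomp Require Import all_boot all_algebra.
From mathcomp Require Import mpoly.

Set Implicit Arguments.
Unset Strict Implicit.
Unset Printing Implicit Defensive.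

Import GRing.Theory.
Local Open Scope ring_scope.

Record derivation (K : fieldType) := Derivation {
  der :> {additive K -> K};
  derM : forall x y : K, der (x * y) = der x * y + x * der y
}.

Definition constants (K : fieldType) (d : derivation K) : {pred K} :=
  [pred c : K | d c == 0].

Lemma der1 (K : fieldType) (d : derivation K) : d 1 = 0.
Proof.
have := derM d 1 1; rewrite !mulr1 mul1r => /eqP.
by rewrite -subr_eq0 opprD addNKr oppr_eq0 => /eqP.
Qed.

Fact constants_divring_closed (K : fieldType) (d : derivation K) :
  divring_closed (constants d).
Proof.
split=> [|x y|x y]; rewrite !inE ?der1 // => /eqP dx0 /eqP dy0.
  by rewrite raddfB dx0 dy0 subrr.
have [->|y0] := eqVneq y 0; first by rewrite invr0 mulr0 raddf0.
have := derM d (x / y) y; rewrite divfK // dx0 dy0 mulr0 addr0 => /esym/eqP.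
by rewrite mulf_eq0 (negPf y0) orbF.
Qed.
HB.instance Definition _ (K : fieldType) (d : derivation K) :=
  GRing.isDivringClosed.Build K (constants d) (constants_divring_closed d).

Definition constants_alg_closed (K : fieldType) (d : derivation K) : Prop :=
  forall p : {poly K}, p \is a polyOver (constants d) -> (1 < size p)%N ->
  exists2 c : K, c \in constants d & root p c.

(* An element P : diffop d is the operator \sum_i P`_i D^i, coefficients on   *)
(* the left. It shares its carrier and additive structure with {poly K}, but  *)
(* its product is composition of operators, determined by D a = a D + d a;    *)
(* odlmul is left multiplication by D.                                        *)
Definition diffop (K : fieldType) (d : derivation K) : Type := {poly K}.

HB.instance Definition _ (K : fieldType) (d : derivation K) :=
  GRing.Zmodule.copy (diffop d) {poly K}.

Section DiffopRing.
Variables (K : fieldType) (d : derivation K).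
Implicit Types p q r : {poly K}.

Definition odlmul p : {poly K} := 'X * p + map_poly d p.

Definition opmul p q : {poly K} :=
  \sum_(i < size p) p`_i *: iter i odlmul q.

Lemma odlmulD p q : odlmul (p + q) = odlmul p + odlmul q.
Proof. by rewrite /odlmul mulrDr raddfD /= addrACA. Qed.

Lemma odlmul0 : odlmul 0 = 0.
Proof. by rewrite /odlmul mulr0 raddf0 addr0. Qed.

Lemma odlmulZ a p : odlmul (a *: p) = a *: odlmul p + d a *: p.
Proof.
rewrite /odlmul -scalerAr scalerDr -!addrA; congr (_ + _).
by apply/polyP=> i; rewrite !(coefD, coefZ, coef_map) /= derM addrC.
Qed.

Lemma odlmul_sum (I : Type) (s : seq I) (P : pred I) (F : I -> {poly K}) :
  odlmul (\sum_(i <- s | P i) F i) = \sum_(i <- s | P i) odlmul (F i).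
Proof. exact: (big_morph odlmul odlmulD odlmul0). Qed.

Lemma iter_odlmulD n p q :
  iter n odlmul (p + q) = iter n odlmul p + iter n odlmul q.
Proof. by elim: n => //= n ->; rewrite odlmulD. Qed.

Lemma opmul_wide n p q : (size p <= n)%N ->
  opmul p q = \sum_(i < n) p`_i *: iter i odlmul q.
Proof.
move=> le_p_n; rewrite /opmul (big_ord_widen n (fun i => p`_i *: iter i odlmul q) le_p_n).
rewrite big_mkcond /=; apply: eq_bigr => i _; case: ltnP => // le_p_i.
by rewrite nth_default // scale0r.
Qed.

Lemma opmulDl p q r : opmul (p + q) r = opmul p r + opmul q r.
Proof.
pose n := maxn (size p) (size q).
rewrite (@opmul_wide n (p + q)) ?size_polyD //.
rewrite (@opmul_wide n p) ?leq_maxl // (@opmul_wide n q) ?leq_maxr //.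
by rewrite -big_split /=; apply: eq_bigr => i _; rewrite coefD scalerDl.
Qed.

Lemma opmul0l r : opmul 0 r = 0.
Proof. by rewrite /opmul size_poly0 big_ord0. Qed.

Lemma opmulDr p q r : opmul p (q + r) = opmul p q + opmul p r.
Proof.
rewrite /opmul -big_split /=; apply: eq_bigr => i _.
by rewrite iter_odlmulD scalerDr.
Qed.

Lemma opmulZl a p q : opmul (a *: p) q = a *: opmul p q.
Proof.
rewrite (@opmul_wide (size p) (a *: p)) ?size_scale_leq // scaler_sumr.
by apply: eq_bigr => i _; rewrite coefZ scalerA.
Qed.

Lemma opmul_dl p q : opmul (odlmul p) q = odlmul (opmul p q).
Proof.
rewrite opmulDl /opmul odlmul_sum.
have -> : \sum_(i < size ('X * p)) ('X * p)`_i *: iter i odlmul q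
    = \sum_(i < size p) p`_i *: iter i.+1 odlmul q.
  rewrite -/(opmul ('X * p) q) (@opmul_wide (size p).+1); last first.
    rewrite mulrC; have [->|p0] := eqVneq p 0.
      by rewrite mul0r size_poly0.
    by rewrite size_mulX.
  rewrite big_ord_recl coefXM /= scale0r add0r.
  by apply: eq_bigr => i _; rewrite coefXM.
have -> : \sum_(i < size (map_poly d p)) (map_poly d p)`_i *: iter i odlmul q
    = \sum_(i < size p) d p`_i *: iter i odlmul q.
  rewrite -/(opmul (map_poly d p) q) (@opmul_wide (size p)) ?size_poly //.
  by apply: eq_bigr => i _; rewrite coef_map.
by rewrite -big_split /=; apply: eq_bigr => i _; rewrite odlmulZ.
Qed.

Lemma opmulA : associative opmul.
Proof.
move=> p q r; rewrite [opmul p q]/opmul [LHS]/opmul.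
rewrite (big_morph (opmul^~ r) (fun x y => opmulDl x y r) (opmul0l r)).
apply: eq_bigr => i _; rewrite opmulZl; congr (_ *: _).
by elim: (i : nat) => //= n ->; rewrite opmul_dl.
Qed.

Lemma opmul1l : left_id 1 opmul.
Proof. by move=> p; rewrite /opmul size_poly1 big_ord1 coef1 scale1r. Qed.

Lemma opmul1r : right_id 1 opmul.
Proof.
move=> p; rewrite /opmul -[RHS]coefK poly_def; apply: eq_bigr => i _.
congr (_ *: _); elim: (i : nat) => [|n IHn] /=; first by rewrite expr0.
rewrite IHn /odlmul -exprS -[RHS]addr0; congr (_ + _).
apply/polyP=> j; rewrite coef_map coefXn coef0 /=.
by case: (_ == _); rewrite ?der1 ?raddf0.
Qed.

Fact opmul1_neq0 : (1 : diffop d) != 0.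
Proof. exact: (oner_neq0 {poly K}). Qed.

HB.instance Definition _ := GRing.Zmodule_isNzRing.Build (diffop d)
  opmulA opmul1l opmul1r opmulDl opmulDr opmul1_neq0.

End DiffopRing.

Section Operators.
Variables (K : fieldType) (d : derivation K).

Definition opC (a : K) : diffop d := a%:P.

Definition opD : diffop d := 'X.

Fact opC_is_zmod_morphism : zmod_morphism opC.
Proof. exact: raddfB (@polyC K). Qed.
Fact opC_is_monoid_morphism : monoid_morphism opC.
Proof.
split=> // a b; rewrite /opC -[RHS]/(opmul d a%:P b%:P).
rewrite (@opmul_wide _ _ 1) ?size_polyC_leq1 // big_ord1 coefC /=.
by rewrite -mul_polyC polyCM.
Qed.
HB.instance Definition _ :=
  GRing.isZmodMorphism.Build K (diffop d) opC opC_is_zmod_morphism.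
HB.instance Definition _ :=
  GRing.isMonoidMorphism.Build K (diffop d) opC opC_is_monoid_morphism.

Lemma opD_opC (a : K) : opD * opC a = opC a * opD + opC (d a).
Proof.
rewrite -[LHS]/(opmul d 'X a%:P) -[opC a * opD]/(opmul d a%:P 'X).
rewrite (@opmul_wide _ _ 2) ?size_polyX // (@opmul_wide _ _ 1 a%:P) ?size_polyC_leq1 //.
rewrite !big_ord_recl !big_ord0 /= !coefX coefC /= scale0r scale1r add0r !addr0.
by rewrite /odlmul map_polyC /= mulrC mul_polyC.
Qed.

(* The zero operator gets order 0. *)
Definition oporder (P : diffop d) : nat := (size (P : {poly K})).-1.

Definition const_coef (P : diffop d) : Prop :=
  (P : {poly K}) \is a polyOver (constants d).

Definition rdvd (Q P : diffop d) : Prop := exists R : diffop d, P = R * Q.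

Definition is_gcrd (G : diffop d) (s : seq (diffop d)) : Prop :=
  [/\ (G : {poly K}) \is monic,
      forall P, P \in s -> rdvd G P
    & forall Q, (forall P, P \in s -> rdvd Q P) -> rdvd Q G].

Definition centralizes (L A : diffop d) : Prop := L * A = A * L.

(* p(L), where p is meant to have constant coefficients *)
Definition opeval (p : {poly K}) (L : diffop d) : diffop d :=
  (map_poly opC p).[L].

Definition const_poly_in (L A : diffop d) : Prop :=
  exists2 p : {poly K}, p \is a polyOver (constants d) & A = opeval p L.

Definition nontrivial_centralizer (L : diffop d) : Prop :=
  ~ (forall A, centralizes L A <-> const_poly_in L A).

Definition minimal_order_mod3 (L : diffop d) (i : nat) (A : diffop d) : Prop :=
  [/\ centralizes L A, oporder A = i %[mod 3]
    & forall B, centralizes L B -> oporder B = i %[mod 3] ->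
      (oporder A <= oporder B)%N].

Definition centralizer_basis (L A1 A2 : diffop d) : Prop :=
  [/\ minimal_order_mod3 L 1 A1,
      minimal_order_mod3 L 2 A2
    & forall A, centralizes L A ->
      exists! p : {poly K} * {poly K} * {poly K},
        [/\ p.1.1 \is a polyOver (constants d),
            p.1.2 \is a polyOver (constants d),
            p.2 \is a polyOver (constants d)
          & A = opeval p.1.1 L + opeval p.1.2 L * A1 + opeval p.2 L * A2]].

(* The variables 'X_0, 'X_1, 'X_2 of {mpoly K[3]} are lambda, mu_1, mu_2. *)
Definition curve_eval (L A1 A2 : diffop d) (g : {mpoly K[3]}) : diffop d :=
  mmap opC (tnth [tuple L; A1; A2]) g.

Definition BC (L A1 A2 : diffop d) (g : {mpoly K[3]}) : Prop :=
  g \is a mpolyOver 3 (constants d) /\ curve_eval L A1 A2 g = 0.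

Definition diff_ideal (I : {mpoly K[3]} -> Prop) : Prop :=
  [/\ I 0,
      forall f g, I f -> I g -> I (f + g),
      forall f g, I g -> I (f * g)
    & forall f, I f -> I (map_mpoly d f)].

Definition diff_ideal_gen (B : {mpoly K[3]} -> Prop) (f : {mpoly K[3]}) : Prop :=
  forall I, diff_ideal I -> (forall g, B g -> I g) -> I f.

End Operators.

(* (F, dF) is the differential field Sigma(Gamma), described up to unique     *)
(* isomorphism: pi is the class map from Sigma[lambda, mu_1, mu_2], its       *)
(* kernel is the differential ideal [BC(L)], and F consists of the fractions  *)
(* of classes. Such an F exists because [BC(L)] is prime.                     *)
Definition curve_function_field (K : fieldType) (d : derivation K)
    (L A1 A2 : diffop d) (F : fieldType) (dF : derivation F)
    (pi : {rmorphism {mpoly K[3]} -> F}) : Prop :=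
  [/\ forall f, pi f = 0 <-> diff_ideal_gen d (BC L A1 A2) f,
      forall z : F, exists f g, pi g != 0 /\ z = pi f / pi g
    & forall f, dF (pi f) = pi (map_mpoly d f)].

(* Two bases of the centralizer give two presentations pi and pi' of the same *)
(* field Sigma(Gamma); they are identified when both restrict to the same     *)
(* embedding of Sigma and an operator g(L, A1, A2) = h(L, B1, B2) of the      *)
(* centralizer has a single class pi g = pi' h.                               *)
Definition same_presentation (K : fieldType) (d : derivation K)
    (L A1 A2 B1 B2 : diffop d) (F : fieldType)
    (pi pi' : {rmorphism {mpoly K[3]} -> F}) : Prop :=
  (forall a : K, pi a%:MP = pi' a%:MP) /\
  (forall g h : {mpoly K[3]},
     g \is a mpolyOver 3 (constants d) -> h \is a mpolyOver 3 (constants d) ->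
     curve_eval L A1 A2 g = curve_eval L B1 B2 h -> pi g = pi' h).

Definition oplift (K : fieldType) (d : derivation K) (F : fieldType)
    (dF : derivation F) (pi : {rmorphism {mpoly K[3]} -> F})
    (P : diffop d) : diffop dF :=
  map_poly (pi \o @mpolyC 3 K) (P : {poly K}).

Definition curve_operators (K : fieldType) (d : derivation K)
    (L A1 A2 : diffop d) (F : fieldType) (dF : derivation F)
    (pi : {rmorphism {mpoly K[3]} -> F}) : seq (diffop dF) :=
  [:: oplift dF pi L - opC dF (pi 'X_0);
      oplift dF pi A1 - opC dF (pi 'X_1);
      oplift dF pi A2 - opC dF (pi 'X_2)].

(* Main.v *)
From HB Require Import structures.
Require Import Defs.
From mathcomp Require Import all_boot all_algebra.
From mathcomp Require Import mpoly.

Set Implicit Arguments.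
Unset Strict Implicit.
Unset Printing Implicit Defensive.

Import GRing.Theory.
Local Open Scope ring_scope.

(** Write K for the base differential field, R for the centralizer of L, and
    L^i A1^j A2^k for the monomials in the generators of R.  The ring K[D] is a
    module over K[lambda, mu_1, mu_2]: scalars of K multiply an operator on the
    left, while lambda, mu_1, mu_2 multiply it on the right by L, A1, A2
    ([act]).  The theorem holds because this module has rank one over the curve.

    - Orders.  The orders of 1, A1, A2 are distinct modulo 3 and L has order 3,
      so the operators L^i A_j (with A_0 = 1) have pairwise distinct orders, and
      these orders omit only finitely many integers.  Distinctness makes the
      operators linearly independent over K ([opeval_free]), so a polynomial
      vanishes on the curve exactly when it annihilates the operator 1
      ([pi_eq0_act], [act_eq0_pi]).  Cofiniteness makes the K-span of the
      L^i A_j, which is the orbit of 1, of finite codimension in K[D], so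
      some nontrivial K-linear combination of P, P L, P L^2, ... lies in it:
      each operator P has a multiple g.P = f.1 with g a nonzero polynomial in
      lambda ([generic_rank]).
    - The factor.  Take g.D = f.1 and phi = - f / g in the function field F.
      After localization the module is the line F.1, on which D sends 1 to
      - phi.1; hence D + phi kills 1.  An operator P sends 1 to P.1, and its
      remainder in the right division by D + phi is the unique z in F with
      P.1 = z.1 ([value_remainder], [value_inj]).  For P = L, A1, A2 this z is
      lambda, mu_1, mu_2, so D + phi divides L - lambda, A1 - mu_1, A2 - mu_2.
    - Maximality.  If Q is a common right divisor of these three operators,
      then modulo the left ideal F[D] Q right multiplication by L, A1, A2 is
      multiplication by lambda, mu_1, mu_2 ([rdvd_act]).  The relation
      g.D = f.1 becomes g D = f modulo Q, so Q divides D + phi.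

    The commutation of A1 and A2, needed for [act] to be a module structure,
    comes from the basis itself ([basis_comm]).  Modulo D + phi, as modulo
    any common divisor Q, every operator g(L, A1, A2) of the centralizer is
    congruent to its class in F, not only the generators; so the same D + phi is
    the greatest common divisor for every other basis. *)

(** * Orders of differential operators *)

Section OperatorOrder.
Variables (K : fieldType) (d : derivation K).
Implicit Types P Q L : diffop d.
Local Notation opsize P := (size (P : {poly K})).

Lemma opC_mul a P : opC d a * P = a *: (P : {poly K}).
Proof.
rewrite -[LHS]/(opmul d a%:P P) (@opmul_wide _ _ 1) ?size_polyC_leq1 //.
by rewrite big_ord1 coefC.
Qed.

Lemma opD_mul P : opD d * P = odlmul d P.
Proof.
rewrite -[LHS]/(opmul d 'X P) (@opmul_wide _ _ 2) ?size_polyX //.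
by rewrite !big_ord_recl big_ord0 /= !coefX /= scale0r scale1r add0r addr0.
Qed.

(** The closure conditions are those of a left ideal containing 1; they suffice
    because an operator is a sum of terms a D^i. *)
Lemma diffop_ind (T : diffop d -> Prop) :
  T 1 -> (forall P Q, T P -> T Q -> T (P + Q)) ->
  (forall a P, T P -> T (opC d a * P)) -> (forall P, T P -> T (opD d * P)) ->
  forall P, T P.
Proof.
move=> T1 TD TC TX P; rewrite -[P]mulr1 -[_ * _]/(opmul d P 1) /opmul.
have T0 : T 0 by rewrite -(mul0r (1 : diffop d)) -(raddf0 (opC d)); apply: TC.
elim/big_ind: _ => //= i _; rewrite -opC_mul; apply: (TC).
by elim: (i : nat) => //= k IH; rewrite -opD_mul; apply: TX.
Qed.

Lemma opsize_gt0 P : (0 < opsize P)%N = (P != 0).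
Proof. exact: size_poly_gt0. Qed.

Lemma size_iter_odlmul (q : {poly K}) i :
  q != 0 -> size (iter i (odlmul d) q) = (i + size q)%N.
Proof.
move=> q0; elim: i => //= i IHi.
have s0 : iter i (odlmul d) q != 0.
  by rewrite -size_poly_gt0 IHi addn_gt0 size_poly_gt0 q0 orbT.
rewrite /odlmul size_polyDl mulrC size_mulX // IHi // ltnS -IHi.
exact: size_poly.
Qed.

(** The derivative terms in D^i Q have lower order than D^i Q itself, so the
    leading terms multiply as in the commutative polynomial ring. *)
Lemma size_opmul P Q : P != 0 -> Q != 0 ->
  opsize (P * Q) = (opsize P + opsize Q).-1.
Proof.
move=> P0 Q0; rewrite -[P * Q]/(opmul d P Q) /opmul.
have sP : (0 < opsize P)%N by rewrite size_poly_gt0.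
have lP : (P : {poly K})`_(opsize P).-1 != 0.
  by rewrite -/(lead_coef (P : {poly K})) lead_coef_eq0.
case: (opsize P) sP lP => // n _ /= lP.
rewrite big_ord_recr /= addrC size_polyDl size_scale // size_iter_odlmul //.
rewrite -[X in (_ < X)%N]prednK ?addn_gt0 ?size_poly_gt0 ?Q0 ?orbT // ltnS.
apply: (leq_trans (size_sum _ _ _)); apply/bigmax_leqP => i _.
rewrite (leq_trans (size_scale_leq _ _)) // size_iter_odlmul // -ltnS prednK.
  by rewrite ltn_add2r.
by rewrite addn_gt0 size_poly_gt0 Q0 orbT.
Qed.

Lemma opmul_neq0 P Q : P != 0 -> Q != 0 -> P * Q != 0.
Proof.
move=> P0 Q0; rewrite -opsize_gt0 size_opmul //; move: P0 Q0.
rewrite -!opsize_gt0; case: (opsize P) => // p; case: (opsize Q) => // q.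
by rewrite addnS.
Qed.

Lemma opeval0 L : opeval 0 L = 0.
Proof. by rewrite /opeval rmorph0 horner0. Qed.

Lemma opevalXaddC p a L : opeval (p * 'X + a%:P) L = opeval p L * L + opC d a.
Proof.
rewrite /opeval rmorphD rmorphM /= map_polyX map_polyC /=.
by rewrite hornerMXaddC.
Qed.

Lemma size_opeval (p : {poly K}) L : (1 < opsize L)%N -> p != 0 ->
  opsize (opeval p L) = ((size p).-1 * (opsize L).-1).+1.
Proof.
move=> sL; elim/poly_ind: p => [|p a IHp]; first by rewrite eqxx.
have L0 : L != 0 by rewrite -opsize_gt0 ltnW.
rewrite opevalXaddC; have [-> | p0 _] := eqVneq p 0.
  rewrite !mul0r !add0r polyC_eq0 => a0; rewrite opeval0 mul0r add0r.
  by rewrite !size_polyC a0.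
have E0 : opeval p L != 0 by rewrite -opsize_gt0 IHp.
have sE : opsize (opeval p L * L) = (size p * (opsize L).-1).+1.
  rewrite size_opmul // IHp //; move: p0 sL; rewrite -size_poly_gt0.
  case: (size p) => // k _; case: (opsize L) => // l _.
  by rewrite /= addnS mulSn addnC.
rewrite [LHS]size_polyDl sE; first by rewrite size_MXaddC (negPf p0).
rewrite size_polyC (leq_ltn_trans (leq_b1 _)) // ltnS.
rewrite muln_gt0 size_poly_gt0 p0 /=.
by rewrite -ltnS prednK // ltnW.
Qed.

End OperatorOrder.

(** * The action of polynomials on operators *)

Lemma mmap1D (n : nat) (S : nzRingType) (h : 'I_n -> S) (m1 m2 : 'X_{1..n}) :
  (forall i j, GRing.comm (h i) (h j)) ->
  mmap1 h (m1 + m2) = mmap1 h m1 * mmap1 h m2.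
Proof.
move=> hC; rewrite /mmap1.
(* The invariant records that the first product commutes with all the [h j],
   so that the next power taken from the second product can move past it. *)
pose I (x y z : S) := z = x * y /\ forall j, GRing.comm (h j) x.
suff [] : I (\prod_(i < n) h i ^+ m1 i) (\prod_(i < n) h i ^+ m2 i)
            (\prod_(i < n) h i ^+ (m1 + m2)%MM i) by [].
elim/big_rec3: _ => [|i z y x _ [-> xC]].
  by split=> [|j]; [rewrite mulr1 | apply: commr1].
split=> [|j]; last by apply: commrM => //; apply: commrX.
rewrite mnmDE exprD -!mulrA; congr (_ * _); rewrite !mulrA; congr (_ * _).
exact/commr_sym/commrX/commr_sym.
Qed.

Section Action.
Variables (n : nat) (K : fieldType) (d : derivation K) (u : 'I_n -> diffop d).
Hypothesis uC : forall i j, GRing.comm (u i) (u j).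
Implicit Types (P Q : diffop d) (g h : {mpoly K[n]}).

Definition lmulop P (a : K) : diffop d := opC d a * P.

Fact lmulop_is_zmod_morphism P : zmod_morphism (lmulop P).
Proof. by move=> a b; rewrite /lmulop raddfB mulrBl. Qed.
HB.instance Definition _ P :=
  GRing.isZmodMorphism.Build K (diffop d) (lmulop P)
    (lmulop_is_zmod_morphism P).

(** [act g P] is the sum of the g_m P u^m: coefficients act on the left and
    variables on the right.  Written as [mmap] along the additive, in general
    not multiplicative, map a |-> a P. *)
Definition act g P : diffop d := mmap (lmulop P) u g.

Lemma act0l P : act 0 P = 0. Proof. exact: raddf0. Qed.
Lemma actDl g h P : act (g + h) P = act g P + act h P.
Proof. exact: raddfD. Qed.
Lemma actBl g h P : act (g - h) P = act g P - act h P.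
Proof. exact: raddfB. Qed.

Lemma act1r g : act g 1 = mmap (opC d) u g.
Proof. by apply: eq_bigr => m _; rewrite /lmulop mulr1. Qed.

Lemma actDr g P Q : act g (P + Q) = act g P + act g Q.
Proof.
by rewrite -big_split; apply: eq_bigr => m _; rewrite /lmulop mulrDr mulrDl.
Qed.

Lemma opC_comm a b : opC d a * opC d b = opC d b * opC d a.
Proof. by rewrite -!rmorphM mulrC. Qed.

Lemma act_opC g a P : act g (opC d a * P) = opC d a * act g P.
Proof.
rewrite /act /mmap mulr_sumr; apply: eq_bigr => m _.
by rewrite /lmulop !mulrA opC_comm.
Qed.

Lemma act0r g : act g 0 = 0.
Proof. by rewrite /act /mmap big1 // => m _; rewrite /lmulop mulr0 mul0r. Qed.

Lemma actX m P : act 'X_[m] P = P * mmap1 u m.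
Proof.
by rewrite /act /mmap msuppX big_seq1 mcoeffX eqxx /lmulop rmorph1 mul1r.
Qed.

Lemma act_mpolyX i P : act 'X_i P = P * u i.
Proof. by rewrite actX mmap1U. Qed.

Lemma act_mpolyC a P : act a%:MP P = opC d a * P.
Proof. exact: mmapC. Qed.

Lemma actZ a g P : act (a *: g) P = opC d a * act g P.
Proof.
rewrite /act !(mmapE (maxn (msize g) (msize (a *: g)))) ?leq_maxl ?leq_maxr //.
rewrite mulr_sumr; apply/eq_bigr => m _.
by rewrite mcoeffZ /= /lmulop rmorphM !mulrA.
Qed.

Lemma actM g h P : act (g * h) P = act g (act h P).
Proof.
elim/mpolyind: g => [|a m g _ _ IHg]; first by rewrite mul0r !act0l.
rewrite mulrDl !actDl IHg -scalerAl !actZ actX; congr (_ * _ + _).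
elim/mpolyind: h {g IHg} => [|b m' h _ _ IHh].
  by rewrite mulr0 act0l mul0r.
rewrite mulrDr !actDl IHh -scalerAr !actZ mulrDl -mpolyXD !actX.
by rewrite addmC mmap1D // !mulrA.
Qed.

(** The variables act on the right, hence commute with left multiplication by
    D, so only the coefficients of [g] get differentiated. *)
Lemma act_der g P :
  opD d * act g P = act (map_mpoly d g) P + act g (opD d * P).
Proof.
elim/mpolyind: g => [|a m g _ _ IHg].
  by rewrite raddf0 !act0l mulr0 addr0.
rewrite raddfD /= !actDl mulrDr IHg addrACA; congr (_ + _).
have -> : map_mpoly d (a *: 'X_[m]) = d a *: 'X_[m] :> {mpoly K[n]}.
  apply/mpolyP => m'; rewrite mcoeff_map_mpoly !mcoeffZ mcoeffX.
  by case: eqP => _; rewrite ?mulr1 // !mulr0 raddf0.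
by rewrite !actZ !actX !mulrA opD_opC mulrDl mulrDl addrC.
Qed.

Lemma const_comm c P : c \in constants d -> GRing.comm (opC d c) P.
Proof.
rewrite inE => /eqP c0; elim/diffop_ind: P => [|P Q|a P|P].
- exact: commr1.
- exact: commrD.
- by apply: commrM; apply: opC_comm.
by apply: commrM; rewrite /GRing.comm opD_opC c0 raddf0 addr0.
Qed.

(** Constants are central in the ring of operators: a polynomial with constant
    coefficients acts as right multiplication by its value. *)
Lemma act_const g P : g \is a mpolyOver n (constants d) ->
  act g P = P * act g 1.
Proof.
move=> /mpolyOverP gC; rewrite /act /mmap mulr_sumr; apply: eq_bigr => m _.
by rewrite /lmulop mulr1 !mulrA (const_comm P (gC m)).
Qed.

End Action.

(** * Right divisibility and extension of coefficients *)

Section RightDivisibility.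
Variables (K : fieldType) (d : derivation K).
Implicit Types P Q R : diffop d.

Lemma rdvd0 Q : rdvd Q 0. Proof. by exists 0; rewrite mul0r. Qed.

Lemma rdvdD Q P R : rdvd Q P -> rdvd Q R -> rdvd Q (P + R).
Proof. by move=> [S ->] [T ->]; exists (S + T); rewrite mulrDl. Qed.

Lemma rdvdMl Q P R : rdvd Q P -> rdvd Q (R * P).
Proof. by move=> [S ->]; exists (R * S); rewrite mulrA. Qed.

Lemma rdvdN Q P : rdvd Q P -> rdvd Q (- P).
Proof. by move=> [S ->]; exists (- S); rewrite mulNr. Qed.

Lemma rdvd_opC a Q P : a != 0 -> rdvd Q (opC d a * P) -> rdvd Q P.
Proof.
move=> a0 /(rdvdMl (opC d a^-1)).
by rewrite mulrA -rmorphM mulVf // rmorph1 mul1r.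
Qed.

End RightDivisibility.

Section Lift.
Variables (K : fieldType) (d : derivation K).
Variables (F : fieldType) (dF : derivation F).
Variable pi : {rmorphism {mpoly K[3]} -> F}.
Hypothesis pi_der : forall f, dF (pi f) = pi (map_mpoly d f).
Implicit Types (P Q : diffop d) (G : diffop dF).

Local Notation lift := (@oplift K d F dF pi).

Lemma oplift_opC a : lift (opC d a) = opC dF (pi a%:MP).
Proof. by rewrite /oplift map_polyC. Qed.

Lemma oplift_opD : lift (opD d) = opD dF.
Proof. by rewrite /oplift map_polyX. Qed.

Lemma opliftD P Q : lift (P + Q) = lift P + lift Q.
Proof. exact: (raddfD (map_poly (pi \o @mpolyC 3 K))). Qed.

Lemma oplift0 : lift 0 = 0.
Proof. exact: (raddf0 (map_poly (pi \o @mpolyC 3 K))). Qed.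

Lemma oplift1 : lift 1 = 1.
Proof. exact: (rmorph1 (map_poly (pi \o @mpolyC 3 K))). Qed.

Lemma opliftZ a (p : {poly K}) :
  lift (a *: p : {poly K}) = pi a%:MP *: (lift p : {poly F}).
Proof.
by apply/polyP => k; rewrite coefZ !coef_map /= coefZ mpolyCM rmorphM.
Qed.

Lemma oplift_odlmul (p : {poly K}) : lift (odlmul d p) = odlmul dF (lift p).
Proof.
rewrite [LHS](raddfD (map_poly (pi \o @mpolyC 3 K))) /= rmorphM /= map_polyX.
congr (_ + _); apply/polyP => i; rewrite !(coef_map, coef_map_id0) ?raddf0 //=.
by rewrite pi_der map_mpolyC.
Qed.

Lemma opliftM P Q : lift (P * Q) = lift P * lift Q.
Proof.
rewrite -[P * Q]/(opmul d P Q) -[RHS]/(opmul dF (lift P) (lift Q)) /opmul.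
rewrite -/(opmul dF (lift P) (lift Q)).
rewrite (@opmul_wide _ _ (size (P : {poly K}))); last exact: size_poly.
rewrite (big_morph _ opliftD oplift0); apply: eq_bigr => i _.
rewrite coef_map /= opliftZ; congr (_ *: _).
elim: (i : nat) => //= k <-; exact: oplift_odlmul.
Qed.

(** The variables have zero derivative, so their classes are central. *)
Lemma const_comm_pi (i : 'I_3) G : GRing.comm (opC dF (pi 'X_i)) G.
Proof.
apply: const_comm; rewrite inE pi_der.
suff -> : map_mpoly d ('X_i : {mpoly K[3]}) = 0 by rewrite rmorph0.
apply/mpolyP => m; rewrite mcoeff_map_mpoly mcoeffX mcoeff0.
by case: eqP => _; rewrite ?der1 ?raddf0.
Qed.

Section CommonDivisor.
Variables (u : 'I_3 -> diffop d) (Q : diffop dF).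
Hypothesis Qu : forall i, rdvd Q (lift (u i) - opC dF (pi 'X_i)).

(** Modulo the left ideal generated by [Q], right multiplication by [P] is
    multiplication by the central scalar [z]. *)
Definition eigen P z :=
  (forall G, GRing.comm (opC dF z) G) /\ rdvd Q (lift P - opC dF z).

(** P R - y z = P (R - z) + z (P - y), where centrality of [z] lets it move to
    the left of [P]. *)
Lemma eigenM P R y z : eigen P y -> eigen R z -> eigen (P * R) (y * z).
Proof.
move=> [yC Py] [zC Rz]; split=> [G|].
  by rewrite rmorphM; apply/commr_sym/commrM; apply/commr_sym.
have -> : lift (P * R) - opC dF (y * z) =
    lift P * (lift R - opC dF z) + opC dF z * (lift P - opC dF y).
  rewrite opliftM rmorphM !mulrBr (zC (lift P)) (zC (opC dF y)).
  by rewrite addrA subrK.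
by apply: rdvdD; apply: rdvdMl.
Qed.

Lemma eigen1 : eigen 1 1.
Proof.
split=> [G|]; first by rewrite rmorph1; apply/commr_sym/commr1.
by rewrite oplift1 rmorph1 subrr; apply: rdvd0.
Qed.

Lemma eigen_mmap1 (m : 'X_{1..3}) : eigen (mmap1 u m) (pi 'X_[m]).
Proof.
rewrite mpolyXE_id rmorph_prod /mmap1.
elim/big_rec2: _ => [|i y x _ xy]; first exact: eigen1.
apply: eigenM => //; rewrite rmorphXn; elim: (m i) => [|k IHk].
  by rewrite !expr0; apply: eigen1.
rewrite !exprS; apply: eigenM => //; split=> [G|//]; exact: const_comm_pi.
Qed.

(** Modulo the left ideal of a common right divisor, the action of polynomials
    on operators becomes multiplication by their classes. *)
Lemma rdvd_act g P : rdvd Q (lift (act u g P) - opC dF (pi g) * lift P).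
Proof.
elim/mpolyind: g => [|a m g _ _ IHg].
  by rewrite act0l oplift0 !rmorph0 mul0r subrr; apply: rdvd0.
rewrite actDl actZ actX opliftD !rmorphD /= mulrDl opprD addrACA.
apply: rdvdD => //; rewrite -mul_mpolyC rmorphM rmorphM opliftM oplift_opC.
rewrite -mulrA -mulrBr opliftM; apply: rdvdMl.
have [zC zQ] := eigen_mmap1 m.
by rewrite zC -mulrBr; apply: rdvdMl.
Qed.

End CommonDivisor.
End Lift.

(** * The centralizer of an operator of order three *)

Lemma size_sum3_eq0 (K : fieldType) (x y z : {poly K}) :
  (x != 0 -> (size x %% 3 = 1)%N) -> (y != 0 -> (size y %% 3 = 2)%N) ->
  (z != 0 -> (size z %% 3 = 0)%N) -> x + y + z = 0 ->
  [/\ x = 0, y = 0 & z = 0].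
Proof.
move=> hx hy hz; rewrite -addrA => /eqP; rewrite addr_eq0 => /eqP xE.
have sx : size x = size (y + z) by rewrite xE size_polyN.
have [y0 | y0] := eqVneq y 0; have [z0 | z0] := eqVneq z 0.
- by rewrite xE y0 z0 addr0 oppr0.
- have x0 : x != 0 by rewrite xE y0 add0r oppr_eq0.
  by move: (hx x0) (hz z0); rewrite sx y0 add0r => ->.
- have x0 : x != 0 by rewrite xE z0 addr0 oppr_eq0.
  by move: (hx x0) (hy y0); rewrite sx z0 addr0 => ->.
move: (hy y0) (hz z0) hx; rewrite -size_poly_gt0 sx.
case: (ltngtP (size y) (size z)) => [lt|lt|->] sy sz.
- rewrite addrC size_polyDl // => /(_ _); rewrite size_poly_gt0 z0 => /(_ isT).
  by rewrite sz.
- rewrite size_polyDl // => /(_ _); rewrite size_poly_gt0 y0 => /(_ isT).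
  by rewrite sy.
by move: sz; rewrite sy.
Qed.

Lemma size_cancel_lead (K : fieldType) (p q : {poly K}) :
  q != 0 -> size p = size q ->
  (size (p - (lead_coef p / lead_coef q) *: q)%R < size p)%N.
Proof.
move=> q0 spq; have sp : (0 < size p)%N by rewrite spq size_poly_gt0.
rewrite -[X in (_ < X)%N](prednK sp) ltnS; apply/leq_sizeP => j.
rewrite leq_eqVlt coefB coefZ => /orP[/eqP <-|].
  rewrite -/(lead_coef p) spq -/(lead_coef q) divfK ?subrr //.
  by rewrite lead_coef_eq0.
by rewrite prednK // => sj; rewrite !nth_default -?spq // mulr0 subrr.
Qed.

Lemma forall_ord3 (T : 'I_3 -> Prop) : T 0 -> T 1 -> T 2 -> forall i, T i.
Proof.
move=> T0 T1 T2 [[|[|[|//]]] lt_i].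
- by have -> : Ordinal lt_i = 0 by apply: val_inj.
- by have -> : Ordinal lt_i = 1 by apply: val_inj.
by have -> : Ordinal lt_i = 2 by apply: val_inj.
Qed.

Section ThirdOrder.
Variables (K : fieldType) (d : derivation K) (L : diffop d).
Hypothesis sL : size (L : {poly K}) = 4%N.
Local Notation opsize P := (size (P : {poly K})).

Lemma size_opevalM (p : {poly K}) (B : diffop d) : p != 0 -> B != 0 ->
  opsize (opeval p L * B) = ((size p).-1 * 3 + opsize B)%N.
Proof.
move=> p0 B0; have sE : opsize (opeval p L) = ((size p).-1 * 3).+1.
  by rewrite size_opeval // sL.
rewrite size_opmul // ?sE //.
by rewrite -opsize_gt0 sE.
Qed.

(** The three summands have sizes in different classes modulo 3, so no two of
    them can cancel each other's leading term. *)
Lemma opeval_free (B1 B2 : diffop d) (p0 p1 p2 : {poly K}) :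
  (opsize B1 %% 3 = 2)%N -> (opsize B2 %% 3 = 0)%N -> B2 != 0 ->
  opeval p0 L + opeval p1 L * B1 + opeval p2 L * B2 = 0 ->
  [/\ p0 = 0, p1 = 0 & p2 = 0].
Proof.
move=> s1 s2 B20.
have B10 : B1 != 0 by apply: contra_eqN s1 => /eqP ->; rewrite size_poly0.
have key (p : {poly K}) (B : diffop d) : B != 0 -> opeval p L * B = 0 -> p = 0.
  move=> B0; case: (eqVneq p 0) => // pn0.
  move=> /(congr1 (fun P : diffop d => opsize P)).
  rewrite size_opevalM // size_poly0 => /eqP; rewrite addn_eq0.
  by rewrite (eqn0Ngt (opsize B)) opsize_gt0 B0 andbF.
have ksize (p : {poly K}) (B : diffop d) : B != 0 ->
    opeval p L * B != 0 -> (opsize (opeval p L * B)%R %% 3 = opsize B %% 3)%N.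
  move=> B0; case: (eqVneq p 0) => [->|pn0 _].
    by rewrite opeval0 mul0r eqxx.
  by rewrite size_opevalM // modnMDl.
rewrite -[opeval p0 L]mulr1 => /size_sum3_eq0[x0|y0|z0|e0 e1 e2].
- by rewrite ksize ?oner_eq0 // size_poly1.
- by rewrite ksize.
- by rewrite ksize.
by split; [apply: (key _ 1) | apply: (key _ B1) | apply: (key _ B2)];
   rewrite ?oner_eq0.
Qed.

End ThirdOrder.

Section Basis.
Variables (K : fieldType) (d : derivation K) (L A1 A2 : diffop d).
Hypothesis Lord : oporder L = 3%N.
Hypothesis basisA : centralizer_basis L A1 A2.
Local Notation opsize P := (size (P : {poly K})).
Local Notation u := (tnth [tuple L; A1; A2]).

Lemma sizeL : opsize L = 4%N.
Proof. by move: Lord; rewrite /oporder; case: (opsize L) => //= n ->. Qed.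

Lemma sizeA1 : (opsize A1 %% 3 = 2)%N.
Proof.
have [[_ +] _ _ _] := basisA; rewrite /oporder.
by case: (opsize A1) => [|n] n1 //; rewrite -addn1 -modnDml n1.
Qed.

Lemma sizeA2 : (opsize A2 %% 3 = 0)%N /\ A2 != 0.
Proof.
have [_ [_ + _] _] := basisA; rewrite /oporder.
rewrite -opsize_gt0; case: (opsize A2) => [|n] n1 //; split=> //.
by rewrite -addn1 -modnDml n1.
Qed.

Lemma comm_opeval (A : diffop d) (p : {poly K}) :
  p \is a polyOver (constants d) -> GRing.comm A L -> GRing.comm A (opeval p L).
Proof.
move=> /polyOverP pC AL; rewrite /opeval horner_coef.
apply: commr_sum => i _; apply: commrM; last exact: commrX.
by rewrite coef_map; apply/commr_sym/const_comm.
Qed.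

(** Expand A1^2 = p0(L) + p1(L) A1 + p2(L) A2.  The order of A1^2 is 2 modulo 3,
    which forces p2 <> 0; so p2(L) A2 is a polynomial in L and A1, hence
    commutes with A1, and p2(L) can be cancelled. *)
Lemma basis_comm : GRing.comm A1 A2.
Proof.
have [[A1L _ _] [A2L _ _] span] := basisA.
have /span[[[p0 p1] p2] /= [[c0 c1 c2 E] _]] : centralizes L (A1 * A1).
  by apply: commrM.
have A1L' := commr_sym A1L.
(* If p2 = 0, then 1, A1, A1^2, of orders 0, 1, 2 modulo 3, are dependent over
   the polynomials in L. *)
have p2n0 : p2 != 0.
  apply/eqP => p20; move: E; rewrite p20 opeval0 mul0r addr0 => /eqP.
  rewrite -subr_eq0 -opprB oppr_eq0 => /eqP E.
  have A10 : A1 != 0.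
    by apply: contra_eqN sizeA1 => /eqP ->; rewrite size_poly0.
  have [] := @opeval_free _ _ _ sizeL A1 (A1 * A1) p0 p1 (- 1) sizeA1 _ _ _.
  - rewrite size_opmul // (divn_eq (opsize A1) 3) sizeA1 addnACA -mulnDl.
    by rewrite -[(2 + 2)%N]/3.+1 addnS /= modnMDl.
  - exact: opmul_neq0.
  - by rewrite /opeval rmorphN rmorph1 hornerN hornerC mulN1r.
  - by move=> _ _ /eqP; rewrite oppr_eq0 oner_eq0.
have E2n0 : opeval p2 L != 0.
  by rewrite -opsize_gt0 size_opeval ?sizeL.
have A1E2 := comm_opeval c2 A1L'.
have A1E2A2 : GRing.comm A1 (opeval p2 L * A2).
  have -> : opeval p2 L * A2 = A1 * A1 - (opeval p0 L + opeval p1 L * A1).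
    by rewrite E addrC addKr.
  apply: commrB; first by apply: commrM.
  by apply: commrD; [|apply: commrM]; rewrite //; apply: comm_opeval.
apply/eqP; rewrite -subr_eq0; apply: contraT => /(opmul_neq0 E2n0)/negP[].
by rewrite mulrBr !mulrA -A1E2 -!mulrA A1E2A2 mulrA subrr.
Qed.

Lemma curve_comm i j : GRing.comm (u i) (u j).
Proof.
have [[A1L _ _] [A2L _ _] _] := basisA.
move: i j; apply: forall_ord3; apply: forall_ord3.
- exact: commr_refl.
- exact: A1L.
- exact: A2L.
- exact: (commr_sym A1L).
- exact: commr_refl.
- exact: basis_comm.
- exact: (commr_sym A2L).
- exact: (commr_sym basis_comm).
exact: commr_refl.
Qed.

Lemma centralizes_mmap1 m : centralizes L (mmap1 u m).
Proof.
rewrite /mmap1; elim/big_ind: _ => [|P Q|i _]; first exact: commr1.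
  exact: commrM.
by apply: commrX; apply: (curve_comm 0).
Qed.

(** * Normal forms and the rank of the curve module *)

Definition inlambda (p : {poly K}) : {mpoly K[3]} :=
  (map_poly (@mpolyC 3 K) p).['X_0].

Definition nform (p : {poly K} * {poly K} * {poly K}) : {mpoly K[3]} :=
  inlambda p.1.1 + inlambda p.1.2 * 'X_1 + inlambda p.2 * 'X_2.

Lemma inlambdaE n (p : {poly K}) : (size p <= n)%N ->
  inlambda p = \sum_(i < n) p`_i *: 'X_0 ^+ i.
Proof.
move=> sp; rewrite /inlambda (@horner_coef_wide _ n); last first.
  by rewrite (leq_trans (size_poly _ _)).
by apply: eq_bigr => i _; rewrite coef_map mul_mpolyC.
Qed.

Lemma inlambdaP a p q : inlambda (a *: p + q) = a *: inlambda p + inlambda q.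
Proof.
rewrite /inlambda -mul_polyC rmorphD rmorphM /= map_polyC /=.
by rewrite hornerD hornerCM mul_mpolyC.
Qed.

Lemma nformP a (p q : {poly K} * {poly K} * {poly K}) :
  nform (a *: p.1.1 + q.1.1, a *: p.1.2 + q.1.2, a *: p.2 + q.2) =
  a *: nform p + nform q.
Proof.
rewrite /nform /= !inlambdaP !mulrDl -!scalerAl !scalerDr.
by rewrite [RHS]addrACA [X in _ = X + _]addrACA.
Qed.

Lemma act_inlambda p : act u (inlambda p) 1 = opeval p L.
Proof.
elim/poly_ind: p => [|p a IHp].
  by rewrite /inlambda rmorph0 horner0 act0l opeval0.
have -> : inlambda (p * 'X + a%:P) = 'X_0 * inlambda p + a%:MP.
  rewrite /inlambda rmorphD rmorphM /= map_polyX map_polyC /= hornerMXaddC.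
  by rewrite mulrC.
rewrite actDl (actM curve_comm) IHp act_mpolyX act_mpolyC mulr1.
by rewrite opevalXaddC.
Qed.

Lemma act_nform p : act u (nform p) 1 =
  opeval p.1.1 L + opeval p.1.2 L * A1 + opeval p.2 L * A2.
Proof.
rewrite /nform !actDl ![_ * 'X__]mulrC !(actM curve_comm).
by rewrite !act_inlambda !act_mpolyX.
Qed.

Lemma inlambda_const p : p \is a polyOver (constants d) ->
  inlambda p \is a mpolyOver 3 (constants d).
Proof.
move=> /polyOverP pC; rewrite (inlambdaE (leqnn _)); apply: rpred_sum => i _.
by apply: mpolyOverZ => //; apply: rpredX; apply: mpolyOverX.
Qed.

Lemma nform_const p : p.1.1 \is a polyOver (constants d) ->
  p.1.2 \is a polyOver (constants d) -> p.2 \is a polyOver (constants d) ->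
  nform p \is a mpolyOver 3 (constants d).
Proof.
move=> c0 c1 c2; rewrite /nform !rpredD ?rpredM ?inlambda_const //;
exact: mpolyOverX.
Qed.

Lemma centralizer_span A : centralizes L A ->
  exists2 h, h \is a mpolyOver 3 (constants d) & act u h 1 = A.
Proof.
have [_ _ span] := basisA; move=> /span[p [[c0 c1 c2 ->] _]].
by exists (nform p); [apply: nform_const | apply: act_nform].
Qed.

Lemma nform_act_eq0 p : act u (nform p) 1 = 0 -> nform p = 0.
Proof.
have [s2 A20] := sizeA2.
rewrite act_nform => /(opeval_free sizeL sizeA1 s2 A20)[e0 e1 e2].
by rewrite /nform e0 e1 e2 /inlambda rmorph0 horner0 !mul0r !addr0.
Qed.

(** Multiplication by L raises the size by 3, and the sizes of 1, A1, A2
    represent all classes modulo 3: only finitely many sizes are missed. *)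
Lemma act_size s : (maxn (opsize A1) (opsize A2) < s)%N ->
  exists f, opsize (act u f 1) = s.
Proof.
rewrite gtn_max => /andP[lt1 lt2]; have [s2 A20] := sizeA2; have s1 := sizeA1.
have A10 : A1 != 0 by apply: contra_eqN s1 => /eqP ->; rewrite size_poly0.
have sX i : (size ('X^i : {poly K})).-1 = i by rewrite size_polyXn.
have X0 i : ('X^i : {poly K}) != 0 by rewrite -size_poly_gt0 size_polyXn.
have : (s %% 3 < 3)%N by rewrite ltn_mod.
case E : (s %% 3)%N => [|[|[|//]]] _.
- exists (inlambda 'X^((s - opsize A2) %/ 3) * 'X_2).
  rewrite mulrC (actM curve_comm) act_inlambda act_mpolyX.
  rewrite size_opevalM ?sizeL // sX divnK ?subnK ?(ltnW lt2) //.
  by rewrite -eqn_mod_dvd ?(ltnW lt2) // E s2.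
- exists (inlambda 'X^((s - 1) %/ 3)).
  rewrite act_inlambda -[opeval _ _]mulr1 size_opevalM ?sizeL ?oner_eq0 //.
  have s0 : (0 < s)%N by apply: leq_ltn_trans lt2.
  rewrite sX size_poly1 divnK ?subnK //.
  by rewrite -eqn_mod_dvd // E.
- exists (inlambda 'X^((s - opsize A1) %/ 3) * 'X_1).
  rewrite mulrC (actM curve_comm) act_inlambda act_mpolyX.
  rewrite size_opevalM ?sizeL // sX divnK ?subnK ?(ltnW lt1) //.
  by rewrite -eqn_mod_dvd ?(ltnW lt1) // E s1.
Qed.

Lemma reduce_size (P : diffop d) :
  exists f, (opsize (P - act u f 1)%R <= maxn (opsize A1) (opsize A2))%N.
Proof.
set N := maxn _ _; have [n] := ubnP (opsize P).
elim: n P => // n IHn P sP; have [le_P|lt_P] := leqP (opsize P) N.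
  by exists 0; rewrite act0l subr0.
have [f sf] := act_size lt_P.
have f0 : (act u f 1 : {poly K}) != 0.
  by rewrite -size_poly_gt0 sf; apply: leq_ltn_trans lt_P.
set c := lead_coef (P : {poly K}) / lead_coef (act u f 1 : {poly K}).
have [|h sh] := IHn (P - act u (c *: f) 1).
  rewrite actZ opC_mul; apply: (leq_trans (size_cancel_lead f0 (esym sf))).
  by rewrite -ltnS.
by exists (c *: f + h); rewrite actDl opprD addrA.
Qed.

(** Reduce each P L^i modulo the orbit of 1 to size at most N.  The N + 1
    operators P, P L, ..., P L^N then have linearly dependent remainders, and
    the dependence coefficients are those of [q]. *)
Lemma generic_rank (P : diffop d) : exists q f,
  q != 0 /\ act u (inlambda q) P = act u f 1.
Proof.
set N := maxn (opsize A1) (opsize A2).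
have /fin_all_exists[f sf] : forall i : 'I_N.+1, exists f,
  (opsize (P * L ^+ i - act u f 1)%R <= N)%N by move=> i; apply: reduce_size.
pose M : 'M[K]_(N.+1, N) :=
  \matrix_(i, j) (P * L ^+ i - act u (f i) 1 : {poly K})`_j.
have : kermx M != 0.
  rewrite -mxrank_eq0 mxrank_ker subn_eq0 -ltnNge ltnS.
  exact: rank_leq_col.
move=> /rowV0Pn[v /sub_kermxP vM v0].
pose q := \poly_(i < N.+1) v 0 (inord i).
have qE (i : 'I_N.+1) : q`_i = v 0 i by rewrite coef_poly ltn_ord inord_val.
exists q, (\sum_i v 0 i *: f i); split.
  apply: contraNneq v0 => q0; apply/eqP/rowP => i.
  by rewrite -qE q0 coef0 mxE.
have actS (F : 'I_N.+1 -> {mpoly K[3]}) R :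
    act u (\sum_i F i) R = \sum_i act u (F i) R.
  by apply: (big_morph (act u ^~ R)) => [g h|]; rewrite ?actDl ?act0l.
rewrite (inlambdaE (size_poly _ _)) !actS; apply/eqP; rewrite -subr_eq0 -sumrB.
apply/eqP; transitivity
  (\sum_i v 0 i *: (P * L ^+ i - act u (f i) 1 : {poly K})).
  apply: eq_bigr => i _; rewrite !actZ qE -mulrBr opC_mul; congr (_ *: (_ - _)).
  elim: (i : nat) => [|k IHk].
    by rewrite !expr0 act_mpolyC rmorph1 mul1r mulr1.
  by rewrite exprS (actM curve_comm) IHk act_mpolyX exprSr mulrA.
apply/polyP => j; rewrite coef_sum coef0.
have [ltj|lej] := ltnP j N.
  move/rowP/(_ (Ordinal ltj)): vM; rewrite !mxE => vM.
  by rewrite -[RHS]vM; apply: eq_bigr => i _; rewrite coefZ mxE.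
rewrite big1 // => i _; rewrite coefZ nth_default ?mulr0 //.
exact: leq_trans lej.
Qed.

End Basis.

(** * Values of operators in the function field *)

Lemma der_div (K : fieldType) (d : derivation K) (x y : K) :
  y != 0 -> d (x / y) = (d x - x / y * d y) / y.
Proof.
move=> y0; have := derM d (x / y) y; rewrite divfK // => ->.
by rewrite addrK mulfK.
Qed.

Section FunctionField.
Variables (K : fieldType) (d : derivation K) (L A1 A2 : diffop d).
Hypothesis Lord : oporder L = 3%N.
Hypothesis basisA : centralizer_basis L A1 A2.
Variables (F : fieldType) (dF : derivation F).
Variable pi : {rmorphism {mpoly K[3]} -> F}.
Hypothesis Fpi : curve_function_field L A1 A2 dF pi.
Local Notation u := (tnth [tuple L; A1; A2]).
Local Notation uC := (curve_comm Lord basisA).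
Local Notation lift := (@oplift K d F dF pi).

Let pi_der f : dF (pi f) = pi (map_mpoly d f).
Proof. by case: Fpi. Qed.

(** The polynomials annihilating the whole module form a differential ideal.
    It contains BC(L) since constant polynomials act through their values.
    The annihilator of 1 alone is not visibly stable under derivation, hence the
    quantification over [P]. *)
Lemma pi_eq0_act P f : pi f = 0 -> act u f P = 0.
Proof.
have [kerpi _ _] := Fpi; move=> /kerpi Bf.
suff : forall P, act u f P = 0 by apply.
apply: (Bf (fun f => forall P, act u f P = 0)) => [|g [gC g0] Q].
  split=> [Q|g h g0 h0 Q|g h h0 Q|g g0 Q]; first exact: act0l.
  - by rewrite actDl g0 h0 addr0.
  - by rewrite (actM uC) h0 act0r.
  by have := act_der u g Q; rewrite !g0 mulr0 addr0.
rewrite (act_const u Q gC) act1r.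
by rewrite [mmap _ _ _]g0 mulr0.
Qed.

(** A monomial in L, A1, A2 lies in the centralizer, and its expansion in the
    basis has constant coefficients; so the monomial differs from a
    normal form by an element of BC(L). *)
Lemma nform_exists f :
  exists p, act u f 1 = act u (nform p) 1 /\ pi f = pi (nform p).
Proof.
have [kerpi _ _] := Fpi; have [_ _ span] := basisA.
elim/mpolyind: f => [|a m f _ _ [q [Eq piq]]].
  exists (0, 0, 0).
  by rewrite /nform /inlambda /= rmorph0 horner0 !mul0r !addr0.
have [p [[/= c0 c1 c2 Ep] _]] := span _ (centralizes_mmap1 Lord basisA m).
have Ep' : act u 'X_[m] 1 = act u (nform p) 1.
  by rewrite actX mul1r (act_nform Lord basisA).
have pip : pi 'X_[m] = pi (nform p).
  apply/eqP; rewrite -subr_eq0 -rmorphB; apply/eqP/kerpi => I _; apply.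
  split; first by rewrite rpredB ?mpolyOverX ?nform_const.
  by rewrite /curve_eval -act1r actBl Ep' subrr.
exists (a *: p.1.1 + q.1.1, a *: p.1.2 + q.1.2, a *: p.2 + q.2).
rewrite nformP; split; first by rewrite [RHS]actDl actDl !actZ Ep' Eq.
by rewrite [LHS]rmorphD [RHS]rmorphD -!mul_mpolyC !rmorphM piq pip.
Qed.

Lemma act_eq0_pi f : act u f 1 = 0 -> pi f = 0.
Proof.
have [p [-> ->]] := nform_exists f.
by move=> /(nform_act_eq0 Lord basisA) ->; rewrite rmorph0.
Qed.

Lemma pi_inlambda_neq0 p : p != 0 -> pi (inlambda p) != 0.
Proof.
move=> p0; apply/eqP => /(pi_eq0_act 1).
rewrite (act_inlambda Lord basisA).
move=> /(congr1 (fun P : diffop d => size (P : {poly K}))).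
by rewrite size_opeval ?(sizeL Lord) // size_poly0.
Qed.

(** In the localized module, which is a line over the function field generated
    by 1, this says P = z.1. *)
Definition value P z := exists g f,
  [/\ pi g != 0, act u g P = act u f 1 & z = pi f / pi g].

Lemma value_inj P y z : value P y -> value P z -> y = z.
Proof.
move=> [g [f [g0 Ef ->]]] [g' [f' [g0' Ef' ->]]].
have /act_eq0_pi/eqP : act u (f * g' - f' * g) 1 = 0.
  rewrite actBl mulrC [f' * g]mulrC !(actM uC) -Ef -Ef' -!(actM uC) mulrC.
  by rewrite subrr.
by rewrite rmorphB !rmorphM subr_eq0 => /eqP E; apply/eqP; rewrite eqr_div // E.
Qed.

Lemma value1 : value 1 1.
Proof. by exists 1, 1; rewrite rmorph1 divr1 oner_eq0. Qed.

Lemma value_act h P z : value P z -> value (act u h P) (pi h * z).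
Proof.
move=> [g [f [g0 Ef ->]]]; exists g, (h * f); split=> //.
  by rewrite -(actM uC) mulrC !(actM uC) Ef.
by rewrite rmorphM mulrA.
Qed.

Lemma value_div h P z : pi h != 0 -> value (act u h P) z -> value P (z / pi h).
Proof.
move=> h0 [g [f [g0 Ef ->]]]; exists (g * h), f; split=> //.
- by rewrite rmorphM mulf_neq0.
- by rewrite (actM uC).
by rewrite rmorphM invfM mulrA.
Qed.

Lemma valueD P Q y z : value P y -> value Q z -> value (P + Q) (y + z).
Proof.
move=> [g [f [g0 Ef ->]]] [g' [f' [g0' Ef' ->]]].
exists (g * g'), (g' * f + g * f'); split.
- by rewrite rmorphM mulf_neq0.
- rewrite actDr {1}mulrC (actM uC g') Ef (actM uC g) Ef' actDl.
  by rewrite !(actM uC).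
rewrite rmorphD !rmorphM addf_div //.
by rewrite [pi f * _]mulrC [pi f' * _]mulrC.
Qed.

Lemma valueC a P z : value P z -> value (opC d a * P) (pi a%:MP * z).
Proof.
move=> [g [f [g0 Ef ->]]]; exists g, (a *: f); split=> //.
  by rewrite act_opC Ef actZ.
by rewrite -mul_mpolyC rmorphM mulrA.
Qed.

(** From g.P = f.1 one gets g.(D P) = f'.1 + f.D - g'.P, each term of which has
    a known value. *)
Lemma valueX P z phi : value (opD d) (- phi) -> value P z ->
  value (opD d * P) (dF z - z * phi).
Proof.
move=> vD Pz; have [g [f [g0 Ef zE]]] := Pz.
have -> : dF z - z * phi =
    (pi (map_mpoly d f) * 1 + pi f * - phi + pi (- map_mpoly d g) * z) / pi g.
  rewrite zE der_div // !pi_der rmorphN !mulrDl mulr1 !mulNr mulrN mulNr.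
  rewrite addrAC; congr (_ - _ - _ / _); [exact: mulrAC | exact: mulrC].
apply: value_div => //.
have -> : act u g (opD d * P) =
    act u (map_mpoly d f) 1 + act u f (opD d) + act u (- map_mpoly d g) P.
  apply: (addIr (act u (map_mpoly d g) P)).
  rewrite -addrA -actDl addNr act0l addr0 addrC -act_der Ef act_der.
  by rewrite mulr1.
by apply: valueD; [apply: valueD|]; apply: value_act => //; apply: value1.
Qed.

(** With D.1 = - phi.1, the operator D + phi kills the generator 1, so the value
    of an operator is its remainder in the right division by D + phi. *)
Lemma value_remainder phi P : value (opD d) (- phi) ->
  exists2 z, value P z & rdvd (opD dF + opC dF phi) (lift P - opC dF z).
Proof.
move=> vD; set G := opD dF + opC dF phi; elim/diffop_ind: P => [|P Q|a P|P].
- by exists 1; [apply: value1 | rewrite oplift1 rmorph1 subrr; apply: rdvd0].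
- move=> [y Py Gy] [z Qz Gz]; exists (y + z); first exact: valueD.
  by rewrite opliftD rmorphD opprD addrACA; apply: rdvdD.
- move=> [z Pz Gz]; exists (pi a%:MP * z); first exact: valueC.
  by rewrite (opliftM pi_der) oplift_opC rmorphM -mulrBr; apply: rdvdMl.
move=> [z Pz Gz]; exists (dF z - z * phi); first exact: valueX.
have -> : lift (opD d * P) - opC dF (dF z - z * phi) =
    opD dF * (lift P - opC dF z) + opC dF z * G.
  rewrite (opliftM pi_der) oplift_opD mulrBr opD_opC rmorphB rmorphM /G mulrDr.
  rewrite opprB opprD -!addrA; congr (_ + _).
  by rewrite [RHS]addrCA addKr addrC.
by apply: rdvdD; apply: rdvdMl => //; exists 1; rewrite mul1r.
Qed.

(** The first clause covers all operators g(L, A1, A2), not just the generators: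
    this makes the same factor serve for every basis of the centralizer. *)
Lemma intrinsic_factor : exists phi : F,
  (forall f, rdvd (opD dF + opC dF phi) (lift (act u f 1) - opC dF (pi f))) /\
  (forall Q : diffop dF,
     (forall i, rdvd Q (lift (u i) - opC dF (pi 'X_i))) ->
     rdvd Q (opD dF + opC dF phi)).
Proof.
have [q [f [q0 Ef]]] := generic_rank Lord basisA (opD d).
have g0 := pi_inlambda_neq0 q0; set g := inlambda q in g0 Ef.
exists (- (pi f / pi g)); split=> [h | Q Qu].
  have vD : value (opD d) (- - (pi f / pi g)) by exists g, f; rewrite opprK.
  have [z vz] := value_remainder (act u h 1) vD.
  by rewrite (value_inj vz (value_act h value1)) mulr1.
apply: (rdvd_opC g0).
have -> : opC dF (pi g) * (opD dF + opC dF (- (pi f / pi g))) =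
    (lift (act u f 1) - opC dF (pi f) * lift 1) -
    (lift (act u g (opD d)) - opC dF (pi g) * lift (opD d)).
  rewrite Ef oplift1 mulr1 oplift_opD opprB [RHS]addrC subrKA.
  by rewrite mulrDr -rmorphM mulrN mulrC divfK // rmorphN.
by apply: rdvdD; [|apply: rdvdN]; apply: rdvd_act.
Qed.

End FunctionField.

(** * The intrinsic right factor *)

Lemma curve_operatorsP (K : fieldType) (d : derivation K) (L A1 A2 : diffop d)
    (F : fieldType) (dF : derivation F) (pi : {rmorphism {mpoly K[3]} -> F})
    (Q : diffop dF) :
  (forall P, P \in curve_operators L A1 A2 dF pi -> rdvd Q P) <->
  (forall i, rdvd Q
     (oplift dF pi (tnth [tuple L; A1; A2] i) - opC dF (pi 'X_i))).
Proof.
split=> [QP|Qu P].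
  by apply: forall_ord3; apply: QP; rewrite !inE; apply/or3P;
    [apply: Or31 | apply: Or32 | apply: Or33]; apply/eqP.
by rewrite !inE => /or3P[] /eqP ->; [apply: (Qu 0)|apply: (Qu 1)|apply: (Qu 2)].
Qed.

Theorem theorem6p7 (Sigma : fieldType) (d : derivation Sigma)
    (char0 : [pchar Sigma] =i pred0)
    (Cclosed : constants_alg_closed d)
    (L : diffop d)
    (Lord : oporder L = 3%N)
    (LnC : ~ const_coef L)
    (Lnt : nontrivial_centralizer L)
    (A1 A2 : diffop d)
    (basisA : centralizer_basis L A1 A2)
    (F : fieldType) (dF : derivation F)
    (pi : {rmorphism {mpoly Sigma[3]} -> F})
    (Fpi : curve_function_field L A1 A2 dF pi) :
  exists phi : F,
    rdvd (opD dF + opC dF phi) (oplift dF pi L - opC dF (pi 'X_0)) /\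
    is_gcrd (opD dF + opC dF phi) (curve_operators L A1 A2 dF pi) /\
    forall (B1 B2 : diffop d) (pi' : {rmorphism {mpoly Sigma[3]} -> F}),
      centralizer_basis L B1 B2 ->
      curve_function_field L B1 B2 dF pi' ->
      same_presentation L A1 A2 B1 B2 pi pi' ->
      is_gcrd (opD dF + opC dF phi) (curve_operators L B1 B2 dF pi').
Proof.
have [phi [Gdvd Gmax]] := intrinsic_factor Lord basisA Fpi.
set G := opD dF + opC dF phi in Gdvd Gmax *.
have Gmonic : (G : {poly F}) \is monic.
  by rewrite /G -[phi]opprK rmorphN; apply: monicXsubC.
have Gi i : rdvd G (oplift dF pi (tnth [tuple L; A1; A2] i) - opC dF (pi 'X_i)).
  by have := Gdvd 'X_i; rewrite act_mpolyX mul1r.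
exists phi; split; first exact: (Gi 0).
split.
  split=> // [|Q QP]; first exact/curve_operatorsP.
  exact/Gmax/curve_operatorsP.
move=> B1 B2 pi' basisB Fpi' [piC piE].
have liftE P : oplift dF pi' P = oplift dF pi P.
  by apply/polyP => i; rewrite !coef_map /= piC.
have constX i : ('X_i : {mpoly Sigma[3]}) \is a mpolyOver 3 (constants d).
  exact: mpolyOverX.
have actX1 (v : 'I_3 -> diffop d) i : act v 'X_i 1 = v i.
  by rewrite act_mpolyX mul1r.
(* Each element of one basis is a constant polynomial in L and the other basis;
   the two presentations give it the same class. *)
have transfer g h : g \is a mpolyOver 3 (constants d) ->
    h \is a mpolyOver 3 (constants d) ->
    act (tnth [tuple L; A1; A2]) g 1 = act (tnth [tuple L; B1; B2]) h 1 ->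
    pi g = pi' h.
  by rewrite !act1r; apply: piE.
have [_ _ pi'_der] := Fpi'.
split=> // [|Q /curve_operatorsP QB].
  apply/curve_operatorsP => i; rewrite liftE.
  have [h hC hE] := centralizer_span Lord basisA (curve_comm Lord basisB 0 i).
  rewrite -(transfer h) ?actX1 // -hE.
  exact: Gdvd.
apply: Gmax => i.
have [h hC hE] := centralizer_span Lord basisB (curve_comm Lord basisA 0 i).
rewrite (transfer _ h) ?actX1 // -liftE -hE.
by have := rdvd_act pi'_der QB h 1; rewrite oplift1 mulr1.
Qed.
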